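(* Let $(P_n)_{n\ge 0}$ be the sequence of polynomials defined by $P_0(x)=1$ and $$P_{n+1}(x)=(nx+1)P_n(x)+x(1-x)P_n'(x)\qquad(n\ge 0).$$ For every $q>0$ with $q\ne 1$, every integer $n\ge 1$ and every $x>0$, $$\frac{d^n}{dx^n}\log [x]_q=-(\log q)^n\,\frac{q^{x}P_{n-1}(q^{x})}{(1-q^x)^n}.$$ Hence for $0<q<1$, $a\ge 0$, every integer $n\ge 1$ and every $x>0$, $$\frac{d^n}{dx^n}\psi_q(x+a)=(\log q)^{n+1}\sum_{i=0}^\infty \frac{q^{x+a+i}P_{n}(q^{x+a+i})}{(1-q^{x+a+i})^{n+1}}.$$
   Context: $[x]_q=\frac{1-q^x}{1-q}$. For $0<q<1$ and $x>0$, $\Gamma_q(x)=\frac{(q;q)_\infty}{(q^x;q)_\infty}(1-q)^{1-x}$ with $(a;q)_\infty=\prod_{k=0}^\infty(1-aq^k)$, and the $q$-digamma function is $\psi_q(x)=\frac{d}{dx}\log\Gamma_q(x)$. *)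

(* Defs.v *)
From HB Require Import structures.
From mathcomp Require Import all_boot all_order all_algebra.
From mathcomp Require Import all_classical all_reals all_analysis.

Set Implicit Arguments.
Unset Strict Implicit.
Unset Printing Implicit Defensive.

Import Order.TTheory GRing.Theory Num.Theory.
Import numFieldNormedType.Exports.

Local Open Scope classical_set_scope.
Local Open Scope ring_scope.

(* [deriv] is the formal derivative of polynomials. *)
Fixpoint eulerian_poly (R : realType) (n : nat) : {poly R} :=
  if n is m.+1 then
    (m%:R *: 'X + 1) * eulerian_poly R m + 'X * (1 - 'X) * deriv (eulerian_poly R m)
  else 1.
Arguments eulerian_poly : clear implicits.

Definition qnum (R : realType) (q x : R) : R := (1 - q `^ x) / (1 - q).

(* (a; q)_oo *)
Definition qpoch (R : realType) (a q : R) : R :=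
  limn (fun n : nat => \prod_(0 <= k < n) (1 - a * q ^+ k)).

(* Only meaningful for 0 < q < 1 and 0 < x. *)
Definition qGamma (R : realType) (q x : R) : R :=
  qpoch q q / qpoch (q `^ x) q * (1 - q) `^ (1 - x).

(* [derive1] is the analytic derivative of functions of a real variable. *)
Definition qdigamma (R : realType) (q : R) : R -> R :=
  derive1 (fun x : R => ln (qGamma q x)).

(* [derive1n n f x] is a total operator, with an unspecified value where the
   derivative does not exist, so the existence of the last derivative is
   required separately. That of the lower ones follows when, as in the
   intended use, the predicate holds for every order from 1 to n and every x
   in an open interval. *)
Definition nth_derivative_is (R : realType) (n : nat) (f : R -> R) (x l : R)
    : Prop :=
  derivable (derive1n n.-1 f : R -> R) x 1 /\ derive1n n f x = l.

(* Main.v *)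
(* The Eulerian recursion says that F_0(z) = - log (1 - z) and
   F_n(z) = z P_{n-1}(z) / (1 - z)^n satisfy z F_n'(z) = F_{n+1}(z), so that
   d/dt F_n(q^t) = (log q) F_{n+1}(q^t). The first formula follows by iteration.
   For the second one, log Gamma_q(x) is sum_i F_0(q^(x+i)) plus an affine
   function of x. The sums sum_i F_n(q^(t+i)) can be differentiated termwise:
   F_n(z) = O(z) near 0 gives a geometric majorant of the second derivatives,
   locally uniform in t, and then the first-order Taylor remainders sum up to
   O(h^2). *)
Require Import Defs.
From HB Require Import structures.
From mathcomp Require Import all_boot all_order all_algebra.
From mathcomp Require Import all_classical all_reals all_analysis.
From mathcomp Require Import ring lra.

Set Implicit Arguments.
Unset Strict Implicit.

Import Order.TTheory GRing.Theory Num.Theory.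
Import numFieldNormedType.Exports.
Local Open Scope classical_set_scope.
Local Open Scope ring_scope.

(** * The functions F_n and their differential recursion *)

(** Index 0 is meaningful only for z < 1, since [ln] is 0 on nonpositive reals; the other indices
    allow every z != 1, hence also z = q^x with q > 1. *)
Definition eulerian_frac (R : realType) (n : nat) (z : R) : R :=
  if n is m.+1 then z * (eulerian_poly R m).[z] / (1 - z) ^+ m.+1
  else - ln (1 - z).

Lemma is_derive1_powR_base (R : realType) (q t : R) : 0 < q ->
  is_derive t 1 (powR q) (ln q * q `^ t).
Proof.
move=> q0.
have -> : powR q = expR \o (fun u => u * ln q).
  by apply/funext => u /=; rewrite /powR gt_eqF.
have dl : is_derive t 1 (fun u : R => u * ln q) (ln q).
  have H := is_deriveM (is_derive_id t 1) (is_derive_cst (ln q) t 1).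
  by apply: (is_derive_eq H); rewrite scaler0 add0r /GRing.scale /= mulr1.
apply: is_derive_eq.
by rewrite mulrC.
Qed.

(** For n >= 1, over the denominator (1 - z)^(n+1) the numerator of z F_n'(z) is z ((1 + (n-1) z)
    P_{n-1} + z (1 - z) P_{n-1}'), which is z P_n by the Eulerian recursion. *)
Lemma is_derive_eulerian_frac (R : realType) (n : nat) (z : R) :
  z != 0 -> (if n is 0 then z < 1 else z != 1) ->
  is_derive z 1 (@eulerian_frac R n) (eulerian_frac n.+1 z / z).
Proof.
have dB : is_derive z 1 (fun y : R => 1 - y) (- 1).
  have H := is_deriveB (is_derive_cst (1 : R) z 1) (is_derive_id z 1).
  by apply: (is_derive_eq H); rewrite sub0r.
case: n => [|n] z0 hz.
  have z1 : 0 < 1 - z by rewrite subr_gt0.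
  have H := is_deriveN 
    (@is_derive1_comp _ (@ln R) (fun y => 1 - y) _ _ _ (is_derive1_ln z1) dB).
  apply: (is_derive_eq H) => /=.
  by rewrite hornerE; field; rewrite z0 gt_eqF.
have z1 : 1 - z != 0 by rewrite subr_eq0 eq_sym.
have HV := @is_deriveX _ _ _ n.+1 _ _ _ 
  (@is_deriveV _ (fun y => 1 - y) _ _ _ z1 dB).
have H := is_deriveM (is_deriveM (is_derive_id z 1)
   (is_derive_poly (eulerian_poly R n) z)) HV.
have -> : @eulerian_frac R n.+1 =
    id * horner (eulerian_poly R n) * (fun y => (1 - y)^-1) ^+ n.+1.
  by apply/funext => y /=; rewrite fctE exprfctE exprVn.
apply: (is_derive_eq H) => /=.
rewrite !hornerE exprfctE /GRing.scale /= mulr1.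
rewrite !exprVn !exprS fctE -natr1 /=.
by field; rewrite z0 expf_neq0.
Qed.

Lemma is_derive_eulerian_frac_powR (R : realType) (n : nat) (q t : R) :
  0 < q -> (if n is 0 then q `^ t < 1 else q `^ t != 1) ->
  is_derive t 1 (fun u => eulerian_frac n (q `^ u))
    (ln q * eulerian_frac n.+1 (q `^ t)).
Proof.
move=> q0 hq; have qt0 : q `^ t != 0 by rewrite gt_eqF // powR_gt0.
have H := is_derive1_comp (is_derive_eulerian_frac qt0 hq)
  (is_derive1_powR_base t q0).
by apply: (is_derive_eq H); rewrite mulrCA divfK.
Qed.

(** * Iterated derivatives on the positive half-line *)

(** The half-line is open, so the identity between the iterated derivative and [g n] holds near each
    of its points and can be differentiated again. *)
Lemma nth_derivative_is_chain (R : realType) (g : nat -> R -> R) :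
  (forall n (x : R), 0 < x -> is_derive x 1 (g n) (g n.+1 x)) ->
  forall n (x : R), 0 < x -> nth_derivative_is n.+1 (g 0%N) x (g n.+1 x).
Proof.
move=> dg.
have nbhs_gt0 (x : R) : 0 < x -> \forall y \near x, 0 < y.
  by move=> x0; apply: lt_nbhsr.
have E n (x : R) : 0 < x -> derive1n n (g 0%N) x = g n x.
  elim: n x => [|n IH] x x0 //.
  rewrite derive1nS derive1E.
  have H : \forall y \near x, derive1n n (g 0%N) y = g n y.
    by near=> y; apply: IH; near: y; exact: nbhs_gt0.
  rewrite (near_eq_derive _ H).
  by have := dg n x x0 => ?; rewrite derive_val.
move=> n x x0; split; last exact: E.
apply: ex_derive; apply: (near_eq_is_derive _ (dg n x x0)).
by near=> y; rewrite E //; near: y; exact: nbhs_gt0.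
Unshelve. all: by end_near.
Qed.

(** * Termwise differentiation of series *)

(** Keeping c no farther from x than y lets the mean value theorem be applied a second time, at c,
    with the same bound on the distance. *)
Lemma mean_value_ball (R : realType) (f df : R -> R) (x r y : R) :
  (forall t, `|t - x| < r -> is_derive t 1 f (df t)) -> `|y - x| < r ->
  exists2 c, `|c - x| <= `|y - x| & f y - f x = df c * (y - x).
Proof.
move=> Df yr.
have hc (a b : R) : (forall t, t \in `[a, b] -> `|t - x| < r) ->
   {within `[a, b], continuous f}.
  move=> h; apply: derivable_within_continuous => t tab.
  exact: (@ex_derive _ _ _ _ _ _ _ (Df t (h t tab))).
have [xy|yx] := leP x y.
  have h t : t \in `[x, y] -> `|t - x| < r.
    rewrite in_itv /= => /andP[xt ty]; apply: le_lt_trans yr.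
    by rewrite !ger0_norm ?subr_ge0 // lerD2r.
  have [|c hcx E] := @MVT_segment _ f df _ _ xy _ (hc _ _ h).
    by move=> t tab; apply: Df; apply: h; exact: subset_itv_oo_cc.
  exists c => //; move: hcx; rewrite in_itv /= => /andP[xt ty].
  by rewrite !ger0_norm ?subr_ge0 // lerD2r.
have {}yx := ltW yx.
have h t : t \in `[y, x] -> `|t - x| < r.
  rewrite in_itv /= => /andP[xt ty]; apply: le_lt_trans yr.
  by rewrite !(distrC _ x) !ger0_norm ?subr_ge0 // lerD2l lerN2.
have [|c hcx E] := @MVT_segment _ f df _ _ yx _ (hc _ _ h).
  by move=> t tab; apply: Df; apply: h; exact: subset_itv_oo_cc.
exists c; last by rewrite -[LHS]opprB E; ring.
move: hcx; rewrite in_itv /= => /andP[xt ty].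
by rewrite !(distrC _ x) !ger0_norm ?subr_ge0 // lerD2l lerN2.
Qed.

(** The mean value theorem for f, then for g, writes the remainder as h(d) (c - x) (y - x) with |c -
    x| <= |y - x|. This gives the constant M instead of M / 2. *)
Lemma taylor1_le (R : realType) (f g h : R -> R) (M x r y : R) :
  (forall t, `|t - x| < r -> is_derive t 1 f (g t)) ->
  (forall t, `|t - x| < r -> is_derive t 1 g (h t)) ->
  (forall t, `|t - x| < r -> `|h t| <= M) -> `|y - x| < r ->
  `|f y - f x - g x * (y - x)| <= M * (y - x) ^+ 2.
Proof.
move=> Df Dg hM yr.
have [c cy ->] := mean_value_ball Df yr.
have cr := le_lt_trans cy yr.
have [d dc E] := mean_value_ball Dg cr.
rewrite -mulrBl E !normrM -[X in _ <= _ * X]ger0_norm ?sqr_ge0 // normrX expr2.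
rewrite mulrA ler_wpM2r // ler_pM // hM //; exact: le_lt_trans cr.
Qed.

Lemma is_derive_quadratic (R : realType) (f : R -> R) (K l x r : R) : 0 < r ->
  (forall y, `|y - x| < r -> `|f y - f x - l * (y - x)| <= K * (y - x) ^+ 2) ->
  is_derive x 1 f l.
Proof.
move=> r0 hf.
suff H : h^-1 *: ((f \o shift x) (h *: (1 : R)) - f x) @[h --> 0^'] --> l.
  by apply: DeriveDef; [apply/cvg_ex; exists l | exact: cvg_lim].
apply/cvgrPdist_le => e e0; near=> h.
have h0 : h != 0 by near: h; exact: nbhs_dnbhs_neq.
have hr : `|h| < r by near: h; apply: dnbhs0_lt.
(* The difference quotient misses l by at most K |h|; [|K| + 1] keeps the denominator positive
   whatever the sign of K. *)
have he : `|h| <= e / (`|K| + 1).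
  by near: h; apply: dnbhs0_le; rewrite divr_gt0 // ltr_wpDl.
have := hf (h + x); rewrite addrK => /(_ hr) {}hf.
rewrite /GRing.scale /= mulr1 distrC.
have -> : h^-1 * (f (h + x) - f x) - l = (f (h + x) - f x - l * h) / h by field.
rewrite normrM normfV ler_pdivrMr ?normr_gt0 //.
apply: (le_trans hf); rewrite -[h ^+ 2]real_normK ?num_real // expr2 mulrA.
rewrite ler_wpM2r //.
rewrite ler_pdivlMr ?ltr_wpDl // in he.
apply: le_trans he; rewrite mulrC ler_wpM2l //.
by rewrite (le_trans (ler_norm K)) // lerDl.
Unshelve. all: by end_near.
Qed.

(** Summing the bounds of [taylor1_le] over i gives a quadratic remainder for the sum, with constant
    [limn (series M)], and [is_derive_quadratic] applies. *)
Lemma is_derive_limn_series (R : realType) (f g h : nat -> R -> R)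
    (M : nat -> R) (x r : R) : 0 < r ->
  (forall i t, `|t - x| < r -> is_derive t 1 (f i) (g i t)) ->
  (forall i t, `|t - x| < r -> is_derive t 1 (g i) (h i t)) ->
  (forall i t, `|t - x| < r -> `|h i t| <= M i) ->
  cvgn (series M) ->
  (forall t, `|t - x| < r -> cvgn (series (f^~ t))) ->
  cvgn (series (g^~ x)) ->
  is_derive x 1 (fun t => limn (series (f^~ t))) (limn (series (g^~ x))).
Proof.
move=> r0 Df Dg hM cM cf cg.
have xr : `|x - x| < r by rewrite subrr normr0.
apply: (@is_derive_quadratic _ _ (limn (series M)) _ _ r r0) => y yr.
pose u : R ^nat := f^~ y - f^~ x - (y - x) *: (g^~ x).
have cgx : cvgn (series ((y - x) *: (g^~ x : R ^nat))) by exact: is_cvg_seriesZ.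
have cfyx : cvgn (series ((f^~ y : R ^nat) - f^~ x)).
  by apply: is_cvg_seriesB; exact: cf.
have -> : limn (series (f^~ y)) - limn (series (f^~ x))
    - limn (series (g^~ x)) * (y - x) = limn (series u).
  rewrite lim_seriesB // lim_seriesB; [|exact: cf|exact: cf].
  by rewrite lim_seriesZ // [in RHS]/GRing.scale /= [X in _ = _ - X]mulrC.
have uM n : `|u n| <= ((y - x) ^+ 2 *: (M : R ^nat)) n.
  have -> : ((y - x) ^+ 2 *: (M : R ^nat)) n = M n * (y - x) ^+ 2.
    exact: mulrC.
  have -> : u n = f n y - f n x - g n x * (y - x).
    by rewrite mulrC.
  exact: (taylor1_le (Df n) (Dg n) (hM n)).
have cM2 : cvgn (series ((y - x) ^+ 2 *: (M : R ^nat))) by exact: is_cvg_seriesZ.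
have cu : cvgn [normed series u].
  apply: series_le_cvg cM2 => // n; first exact: normr_ge0.
  exact: le_trans (normr_ge0 _) (uM n).
apply: (le_trans (lim_series_norm cu)).
apply: (le_trans (lim_series_le cu cM2 uM)).
by rewrite lim_seriesZ // /GRing.scale /= mulrC.
Qed.

(** * Geometric majorants *)

Lemma eulerian_frac_le (R : realType) (n : nat) (b : R) : b < 1 ->
  exists2 C, 0 <= C &
    forall z, 0 < z -> z <= b -> `|eulerian_frac n z| <= C * z.
Proof.
move=> b1; have b1' : 0 < 1 - b by rewrite subr_gt0.
case: n => [|n].
  exists (1 - b)^-1; first by rewrite invr_ge0 ltW.
  move=> z z0 zb /=.
  have z1 : 0 < 1 - z by rewrite subr_gt0 (le_lt_trans zb).
  (* Thus - ln (1 - z) = ln (1 + z / (1 - z)) <= z / (1 - z) <= z / (1 - b). *)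
  have E : (1 - z)^-1 = 1 + z / (1 - z) by field; rewrite gt_eqF.
  have P : 0 <= z / (1 - z) by rewrite divr_ge0 // ltW.
  rewrite -lnV ?posrE // E ger0_norm; last by rewrite ln_ge0 // lerDl.
  apply: (le_trans (le_ln1Dx _)); first by apply: lt_le_trans P.
  by rewrite mulrC ler_wpM2r ?(ltW z0) // lef_pV2 ?posrE // lerD2l lerN2.
have [ub hub] := poly_itv_bound (eulerian_poly R n) 0 b.
exists (`|ub| / (1 - b) ^+ n.+1); first by rewrite divr_ge0 // exprn_ge0 // ltW.
move=> z z0 zb /=.
have z1 : 0 < 1 - z by rewrite subr_gt0 (le_lt_trans zb).
rewrite !normrM (gtr0_norm z0) normfV normrX (gtr0_norm z1) -mulrA mulrC.
rewrite ler_wpM2r ?(ltW z0) // ler_pM ?invr_ge0 ?exprn_ge0 ?(ltW z1) //.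
  by rewrite (le_trans _ (ler_norm ub)) // hub // (ltW z0) zb.
by rewrite lef_pV2 ?posrE ?exprn_gt0 // lerXn2r ?nnegrE ?(ltW z1) ?(ltW b1') // lerD2l lerN2.
Qed.

Lemma powR_addn (R : realType) (q t : R) (i : nat) : 0 < q ->
  q `^ (t + i%:R) = q `^ t * q ^+ i.
Proof.
move=> q0; rewrite powRD; last by apply/implyP => _; rewrite gt_eqF.
by rewrite powR_mulrn ?ltW.
Qed.

Lemma powR_lt1 (R : realType) (q t : R) : 0 < q < 1 -> 0 < t -> q `^ t < 1.
Proof.
move=> q01 t0; have /andP[q0 _] := q01.
by rewrite /powR gt_eqF // expR_lt1 pmulr_rlt0 // ln_lt0.
Qed.

(** For t >= s, q^(t+i) <= q^s q^i, so the linear bound with b = q^s gives one geometric majorant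
    for all these t. *)
Lemma eulerian_frac_dominated (R : realType) (n : nat) (q s : R) :
  0 < q < 1 -> 0 < s ->
  exists2 M : R ^nat, cvgn (series M) &
    forall i t, s <= t -> `|eulerian_frac n (q `^ (t + i%:R))| <= M i.
Proof.
move=> q01 s0; have /andP[q0 q1] := q01.
have [C C0 hC] := eulerian_frac_le n (powR_lt1 q01 s0).
exists (geometric (C * q `^ s) q).
  by apply: is_cvg_geometric_series; rewrite gtr0_norm.
move=> i t st /=.
have q01' : 0 < q <= 1 by rewrite q0 ltW.
have qts : q `^ t <= q `^ s by rewrite ger_powR.
apply: (le_trans (hC _ _ _)); first exact: powR_gt0.
  by rewrite ger_powR // (le_trans st) // lerDl.
rewrite powR_addn // -mulrA ler_wpM2l // ler_wpM2r //.
by rewrite exprn_ge0 // ltW.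
Qed.

(** * The series of F_n along q^(t+i), and the q-digamma function *)

Definition eulerian_series (R : realType) (n : nat) (q t : R) : R :=
  limn (series (fun i => eulerian_frac n (q `^ (t + i%:R)))).

Lemma is_cvg_eulerian_series (R : realType) (n : nat) (q t : R) :
  0 < q < 1 -> 0 < t ->
  cvgn (series (fun i => eulerian_frac n (q `^ (t + i%:R)))).
Proof.
move=> q01 t0; have [M cM hM] := eulerian_frac_dominated n q01 t0.
apply: normed_cvg; apply: series_le_cvg cM => i; [exact: normr_ge0| |exact: hM].
exact: le_trans (normr_ge0 _) (hM i t (lexx _)).
Qed.

Lemma is_derive_shiftr (R : realType) (f : R -> R) (a x l : R) :
  is_derive (x + a) 1 f l -> is_derive x 1 (fun t => f (t + a)) l.
Proof.
move=> df.
have da : is_derive x 1 (fun t => t + a) 1.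
  have H := is_deriveD (is_derive_id x 1) (is_derive_cst a x 1).
  by apply: (is_derive_eq H); rewrite addr0.
have H := @is_derive1_comp _ f (fun t => t + a) _ _ _ df da.
by apply: (is_derive_eq H); rewrite mulr1.
Qed.

Lemma is_derive_eulerian_series (R : realType) (n : nat) (q x : R) :
  0 < q < 1 -> 0 < x ->
  is_derive x 1 (eulerian_series n q) (ln q * eulerian_series n.+1 q x).
Proof.
move=> q01 x0; have /andP[q0 q1] := q01.
(* The ball of radius x / 2 around x stays to the right of x / 2 > 0, so the majorant for s = x / 2
   serves on all of it. *)
have x2 : 0 < x / 2 by rewrite divr_gt0.
have tx t : `|t - x| < x / 2 -> x / 2 < t.
  by rewrite ltr_distl => /andP[+ _]; apply: le_lt_trans; lra.
have dF m i t : `|t - x| < x / 2 ->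
    is_derive t 1 (fun t => eulerian_frac m (q `^ (t + i%:R)))
      (ln q * eulerian_frac m.+1 (q `^ (t + i%:R))).
  move=> /tx xt; apply: (@is_derive_shiftr _ (fun u => eulerian_frac m (q `^ u))).
  apply: is_derive_eulerian_frac_powR => //.
  have h : q `^ (t + i%:R) < 1.
    by rewrite powR_lt1 // ltr_wpDr // (lt_trans x2).
  by case: m; rewrite ?h ?lt_eqF.
(* The second derivative of the i-th term is (ln q)^2 F_{n+2}(q^(t+i)). *)
have [M cM hM] := eulerian_frac_dominated n.+2 q01 x2.
have H := @is_derive_limn_series _
  (fun i t => eulerian_frac n (q `^ (t + i%:R)))
  (fun i t => ln q * eulerian_frac n.+1 (q `^ (t + i%:R)))
  (fun i t => ln q * (ln q * eulerian_frac n.+2 (q `^ (t + i%:R))))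
  ((ln q ^+ 2) *: (M : R ^nat)) x (x / 2) x2 (dF n).
have cn m t : `|t - x| < x / 2 ->
    cvgn (series (fun i => eulerian_frac m (q `^ (t + i%:R)))).
  by move=> /tx xt; apply: is_cvg_eulerian_series => //; exact: lt_trans xt.
have xx : `|x - x| < x / 2 by rewrite subrr normr0.
rewrite /eulerian_series -[X in is_derive _ _ _ X](lim_seriesZ (ln q) (cn n.+1 x xx)).
apply: H.
- move=> i t ht.
  have K := is_deriveZ (ln q) (dF n.+1 i t ht).
  exact: (is_derive_eq K).
- move=> i t /tx/ltW ht; rewrite mulrA normrM -expr2 ger0_norm ?sqr_ge0 //.
  by rewrite ler_wpM2l ?sqr_ge0 ?hM.
- exact: is_cvg_seriesZ.
- exact: cn.
- exact: (is_cvg_seriesZ (cn n.+1 x xx)).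
Qed.

(** Each factor is 1 - q^(x+i) = exp (- F_0(q^(x+i))), so partial products are exponentials of
    partial sums, and exp is continuous. The exponential form also gives the positivity needed to
    take logarithms. *)
Lemma qpoch_powR (R : realType) (q x : R) : 0 < q < 1 -> 0 < x ->
  qpoch (q `^ x) q = expR (- eulerian_series 0 q x).
Proof.
move=> q01 x0; have /andP[q0 q1] := q01.
have c0 := @is_cvg_eulerian_series _ 0 _ _ q01 x0.
have -> : qpoch (q `^ x) q =
    limn (fun n => expR (- series (fun i => eulerian_frac 0 (q `^ (x + i%:R))) n)).
  congr (limn _); apply/funext => n.
  rewrite /series /= -sumrN expR_sum; apply: eq_bigr => i _.
  rewrite opprK lnK ?powR_addn // posrE -powR_addn // subr_gt0.
  by rewrite powR_lt1 // ltr_wpDr.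
apply: cvg_lim => //.
by apply: continuous_cvg; [exact: continuous_expR | exact: cvgN].
Qed.

Lemma qdigammaE (R : realType) (q x : R) : 0 < q < 1 -> 0 < x ->
  qdigamma q x = ln q * eulerian_series 1 q x - ln (1 - q).
Proof.
move=> q01 x0; have /andP[q0 q1] := q01.
rewrite /qdigamma derive1E.
pose G t := (1 - t) * ln (1 - q) + (eulerian_series 0 q t - eulerian_series 0 q 1).
have E : \forall t \near x, ln (qGamma q t) = G t.
  near=> t.
  have t0 : 0 < t by near: t; exact: lt_nbhsr.
  (* Writing q as q^1 makes (q; q)_oo an instance of [qpoch_powR] too; it contributes the constant
     [eulerian_series 0 q 1]. *)
  rewrite /qGamma -{1}(powRr1 (ltW q0)) !qpoch_powR //.
  rewrite lnM ?ln_div ?posrE ?divr_gt0 ?expR_gt0 ?powR_gt0 ?subr_gt0 //.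
  rewrite /G; move: (eulerian_series 0 q 1) (eulerian_series 0 q t) => A B.
  by rewrite 2!expRK ln_powR opprK [RHS]addrC [B - A]addrC.
rewrite (near_eq_derive _ E).
have d0 := @is_derive_eulerian_series _ 0 _ _ q01 x0.
have d1 : is_derive x 1 (fun t => (1 - t) * ln (1 - q)) (- ln (1 - q)).
  have H := is_deriveM (is_deriveB (is_derive_cst (1 : R) x 1) (is_derive_id x 1))
    (is_derive_cst (ln (1 - q)) x 1).
  by apply: (is_derive_eq H); rewrite scaler0 add0r sub0r /GRing.scale /= mulrN1.
have H := is_deriveD d1 (is_deriveB d0 (is_derive_cst (eulerian_series 0 q 1) x 1)).
by rewrite (@derive_val _ _ _ _ _ _ _ H) subr0 addrC.
Unshelve. all: by end_near.
Qed.

(** * The logarithm of [t]_q for q on either side of 1 *)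

Lemma powR_neq1 (R : realType) (q t : R) :
  0 < q -> q != 1 -> t != 0 -> q `^ t != 1.
Proof.
move=> q0 q1 t0; apply: contra_neq q1 => /(congr1 (@ln R)) /eqP.
rewrite ln_powR ln1 mulf_eq0 (negPf t0) /= => /eqP q1.
by apply: ln_inj; rewrite ?posrE // q1 ln1.
Qed.

Lemma qnum_gt0 (R : realType) (q t : R) :
  0 < q -> q != 1 -> 0 < t -> 0 < qnum q t.
Proof.
move=> q0 q1 t0; rewrite /qnum; have [lt1|gt1|E] := ltgtP q 1.
- by rewrite divr_gt0 ?subr_gt0 // powR_lt1 // q0.
- rewrite -mulrNN -invrN !opprB divr_gt0 ?subr_gt0 //.
  by rewrite /powR gt_eqF // expR_gt1 mulr_gt0 // ln_gt0.
- by rewrite E eqxx in q1.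
Qed.

(** For q > 1 both 1 - q^t and 1 - q are negative, so ln [t]_q does not split into - F_0(q^t) - ln
    (1 - q). Differentiating the positive quotient itself covers both ranges of q and lands on
    F_1. *)
Lemma is_derive_ln_qnum (R : realType) (q t : R) :
  0 < q -> q != 1 -> 0 < t ->
  is_derive t 1 (fun s => ln (qnum q s)) (- (ln q * eulerian_frac 1 (q `^ t))).
Proof.
move=> q0 q1 t0.
have qt1 := powR_neq1 q0 q1 (lt0r_neq0 t0).
have dq : is_derive t 1 (qnum q) (- (ln q * q `^ t) / (1 - q)).
  have H := is_deriveM (is_deriveB (is_derive_cst (1 : R) t 1)
    (is_derive1_powR_base t q0)) (is_derive_cst (1 - q)^-1 t 1).
  apply: (is_derive_eq H).
  by rewrite scaler0 add0r sub0r /GRing.scale /= mulrC.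
have H := is_derive1_comp (is_derive1_ln (qnum_gt0 q0 q1 t0)) dq.
apply: (is_derive_eq H).
have -> : eulerian_frac 1 (q `^ t) = q `^ t / (1 - q `^ t).
  by rewrite /eulerian_frac hornerC mulr1 expr1.
rewrite /qnum.
have q1' : 1 - q != 0 by rewrite subr_eq0 eq_sym.
have qt1' : 1 - q `^ t != 0 by rewrite subr_eq0 eq_sym.
by field; rewrite q1' qt1'.
Qed.

Theorem lemma2p2 (R : realType) :
  (forall (q : R), 0 < q -> q != 1 ->
   forall n : nat, (1 <= n)%N -> forall x : R, 0 < x ->
     nth_derivative_is n (fun t : R => ln (qnum q t)) x
       (- ((ln q) ^+ n *
           (q `^ x * (eulerian_poly R n.-1).[q `^ x] / (1 - q `^ x) ^+ n))))
  /\
  (forall (q a : R), 0 < q -> q < 1 -> 0 <= a ->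
   forall n : nat, (1 <= n)%N -> forall x : R, 0 < x ->
     let u : nat -> R := fun i =>
       q `^ (x + a + i%:R) * (eulerian_poly R n).[q `^ (x + a + i%:R)]
       / (1 - q `^ (x + a + i%:R)) ^+ n.+1 in
     cvgn (series u) /\
     nth_derivative_is n (fun t : R => qdigamma q (t + a)) x
       ((ln q) ^+ n.+1 * limn (series u))).
Proof.
split=> [q q0 q1 [//|n] _ x x0 | q a q0 q1 a0 [//|n] _ x x0 u].
  (* From order 1 on the chain consists of F_m with m >= 1, valid on both sides of 1; order 0
     remains the logarithm itself. *)
  pose g n t := if n is m.+1 then - (ln q ^+ m.+1 * eulerian_frac m.+1 (q `^ t))
    else ln (qnum q t).
  apply: (@nth_derivative_is_chain _ g) => // m t t0.
  have qt1 : q `^ t != 1 by exact: powR_neq1 (lt0r_neq0 t0).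
  case: m => [|m] /=; first exact: is_derive_ln_qnum.
  have H := is_deriveN (is_deriveZ (ln q ^+ m.+1)
    (@is_derive_eulerian_frac_powR _ m.+1 _ _ q0 qt1)).
  by apply: (is_derive_eq H); rewrite [in RHS]exprSr -(mulrA (_ ^+ _)).
have q01 : 0 < q < 1 by rewrite q0.
have gt0 t : 0 < t -> 0 < t + a by move=> t0; rewrite ltr_wpDr.
(* The order is now [n.+1] and F_m carries P_{m-1}, so [u i] is F_{n+2} at q^(x+a+i) by
   unfolding. *)
split; first exact: (@is_cvg_eulerian_series _ n.+2 _ _ q01 (gt0 _ x0)).
pose g n t := if n is m.+1 then ln q ^+ m.+2 * eulerian_series m.+2 q (t + a)
  else qdigamma q (t + a).
apply: (@nth_derivative_is_chain _ g) => // m t t0.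
case: m => [|m] /=; last first.
  have H := is_deriveZ (ln q ^+ m.+2) (is_derive_shiftr
    (@is_derive_eulerian_series _ m.+2 _ _ q01 (gt0 _ t0))).
  by apply: (is_derive_eq H); rewrite [in RHS]exprSr -(mulrA (_ ^+ _)).
apply: is_derive_shiftr.
have H := is_deriveB (is_deriveZ (ln q) (@is_derive_eulerian_series _ 1 _ _ q01 (gt0 _ t0)))
  (is_derive_cst (ln (1 - q)) (t + a) 1).
(* [qdigammaE] holds at positive points only, hence near t + a; the constant ln (1 - q) disappears
   on differentiation. *)
have E : \forall s \near t + a,
    (ln q \*: eulerian_series 1 q - cst (ln (1 - q))) s = qdigamma q s.
  near=> s; rewrite qdigammaE //; near: s; exact: lt_nbhsr (gt0 _ t0).
apply: (near_eq_is_derive E).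
by apply: (is_derive_eq H); rewrite subr0 /GRing.scale /= mulrA -expr2.
Unshelve. all: by end_near.
Qed.
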